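(* Let $A$ be a regular system of divisors and let $n=p_1^{a_1}\cdots p_r^{a_r}$ with $r\ge1$ and distinct primes $p_i$, such that each $p_i^{a_i}$ is $A$-primitive. Write $\Phi_{A,n}(x)=\sum_{j=0}^{\varphi_A(n)}a_{A,n}(j)x^j$. Then $a_{A,n}(0)=1$ and for every $k$ with $1\le k\le\varphi_A(n)$, \[ a_{A,n}(k)=-\frac{\mu_A(n)}{k}\sum_{j=1}^k a_{A,n}(k-j)\,\mu_A\big((j,n)_A\big)\,\varphi_A\big((j,n)_A\big). \]
   Context: A regular system of divisors is a family $A=(A(n))_{n\in\mathbb N}$, where each $A(n)$ is a set of positive divisors of $n$, such that: (i) $A(1)=\{1\}$ and $A(mn)=\{de: d\in A(m), e\in A(n)\}$ whenever $\gcd(m,n)=1$; (ii) for every prime power $p^a$ ($a\ge1$) there is a divisor $t=t_A(p^a)$ of $a$ such that $A(p^{it})=\{1,p^t,\dots,p^{it}\}$ for every $0\le i\le a/t$. An integer $m>1$ is $A$-primitive if $A(m)=\{1,m\}$. $\mu_A$ is the inverse of the constant function $1$ under the $A$-convolution $(f*_Ag)(n)=\sum_{d\in A(n)}f(d)g(n/d)$ (multiplicative, with $\mu_A(p^a)=-1$ if $p^a$ is $A$-primitive and $0$ otherwise, $a\ge1$). For $j\in\mathbb Z$, $(j,n)_A=\max\{d\in\mathbb N: d\mid j,\ d\in A(n)\}$; $\zeta_n=e^{2\pi i/n}$; $\Phi_{A,n}(x)=\prod_{1\le j\le n,\ (j,n)_A=1}(x-\zeta_n^j)$; $\varphi_A(n)=\#\{1\le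 j\le n:(j,n)_A=1\}$. *)

(* Defs.v *)
From HB Require Import structures.
From mathcomp Require Import all_boot all_order all_algebra finmap.
From mathcomp Require Import complex.
From mathcomp Require Import reals trigo.
Set Implicit Arguments.
Unset Strict Implicit.
Unset Printing Implicit Defensive.
Import Order.TTheory GRing.Theory Num.Theory.
Local Open Scope ring_scope.
Local Open Scope complex_scope.

(* Arithmetic data are indexed by all of [nat]; the value at 0 is never
   constrained nor used. *)

Record regular_system (A : nat -> {fset nat}) : Prop := RegularSystem {
  rs_dvd : forall n d : nat, (0 < n)%N -> d \in A n -> (d %| n)%N;
  rs_1 : A 1%N = [fset 1%N]%fset;
  rs_coprime : forall m n, (0 < m)%N -> (0 < n)%N -> coprime m n ->
    A (m * n)%N = [fset (d * e)%N | d in A m, e in A n]%fset;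
  rs_prime_pow : forall q b, prime q -> (0 < b)%N ->
    exists2 t, (t %| b)%N & forall i, (i <= b %/ t)%N ->
      A (q ^ (i * t))%N = [fset (q ^ (j * t))%N | j in iota 0 i.+1]%fset }.

Definition A_primitive (A : nat -> {fset nat}) (m : nat) : Prop :=
  (1 < m)%N /\ A m = [fset 1%N; m]%fset.

Definition A_conv (C : pzRingType) (A : nat -> {fset nat})
    (f g : nat -> C) (n : nat) : C :=
  \sum_(d <- A n) f d * g (n %/ d)%N.

(* [g] is a two-sided inverse of [f] for A-convolution, whose unit is the
   indicator of 1. *)
Definition A_inverse (C : pzRingType) (A : nat -> {fset nat})
    (f g : nat -> C) : Prop :=
  forall n, (0 < n)%N ->
    A_conv A f g n = (n == 1%N)%:R /\ A_conv A g f n = (n == 1%N)%:R.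

Definition is_A_mobius (C : pzRingType) (A : nat -> {fset nat})
    (mu : nat -> C) : Prop :=
  A_inverse A (fun=> 1) mu.

(* For n > 0 and regular A the maximum is over a nonempty set, as 1 \in A n. *)
Definition A_gcd (A : nat -> {fset nat}) (j : int) (n : nat) : nat :=
  \max_(d <- A n | (d%:Z %| j)%Z) d.

Definition A_totient (A : nat -> {fset nat}) (n : nat) : nat :=
  size [seq j <- index_iota 1 n.+1 | A_gcd A j%:Z n == 1%N].

(* e^(2 pi i / n) *)
Definition zeta (R : realType) (n : nat) : R[i] :=
  cos (2 * pi / n%:R) +i* sin (2 * pi / n%:R).

Definition A_cyclotomic (R : realType) (A : nat -> {fset nat}) (n : nat) :
    {poly R[i]} :=
  \prod_(1 <= j < n.+1 | A_gcd A j%:Z n == 1%N) ('X - (zeta R n ^+ j)%:P).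

Lemma rs_compl (A : nat -> {fset nat}) : regular_system A ->
  forall n, (0 < n)%N ->
    n \in A n /\ (forall d : nat, d \in A n -> (n %/ d)%N \in A n).
Proof.
move=> rA; elim/ltn_ind => n IH n0.
case: (leqP n 1) => [n1|n1].
  have -> : n = 1%N by apply/eqP; rewrite eqn_leq n1.
  rewrite (rs_1 rA) inE; split=> // d; rewrite inE => /eqP ->.
  by rewrite inE.
have pp := pdiv_prime n1; set q := pdiv n in pp.
have b0 : (0 < logn q n)%N by rewrite logn_gt0 mem_primes pp n0 pdiv_dvd.
set b := logn q n in b0.
have PP : (q ^ b)%N \in A (q ^ b)%N /\
    forall d : nat, d \in A (q ^ b)%N -> (q ^ b %/ d)%N \in A (q ^ b)%N.
  have [t tb /(_ (b %/ t)%N (leqnn _))] := rs_prime_pow rA pp b0.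
  rewrite divnK // => ->; split.
    apply/imfsetP; exists (b %/ t)%N; last by rewrite divnK.
    by change ((b %/ t)%N \in iota 0 (b %/ t).+1); rewrite mem_iota add0n ltnS leqnn.
  move=> d /imfsetP[j jI ->].
  have jb : (j <= b %/ t)%N.
    by move: (jI : j \in iota 0 (b %/ t).+1); rewrite mem_iota add0n ltnS.
  apply/imfsetP; exists (b %/ t - j)%N.
    change ((b %/ t - j)%N \in iota 0 (b %/ t).+1).
    by rewrite mem_iota add0n ltnS leq_subr.
  rewrite mulnBl divnK // expnB // ?prime_gt0 //.
  by rewrite -(divnK tb) leq_mul2r jb orbT.
have qb0 : (0 < q ^ b)%N by rewrite expn_gt0 prime_gt0.
have nE : n = (q ^ b * n`_q^')%N by rewrite -p_part partnC.
have c : coprime (q ^ b) (n`_q^')%N by rewrite -p_part coprime_partC.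
have m0 : (0 < n`_q^')%N by rewrite part_gt0.
set m := (n`_q^')%N in nE c m0.
have mn : (m < n)%N.
  rewrite nE -[ltnLHS]mul1n ltn_pmul2r // -(exp1n b) ltn_exp2r //.
  exact: prime_gt1.
have [mm mC] := IH _ mn m0.
case: PP => qq qC.
rewrite nE (rs_coprime rA) //; split.
  by apply/imfset2P; exists (q ^ b)%N => //; exists m.
move=> d /imfset2P[d1 /= d1q [d2 /= d2m ->]].
apply/imfset2P; exists (q ^ b %/ d1)%N; first exact: qC.
exists (m %/ d2)%N; first exact: mC.
by rewrite /= divnMA -divn_mulAC ?(rs_dvd rA qb0) // muln_divA ?(rs_dvd rA m0).
Qed.

Fixpoint mobius_rec (C : pzRingType) (A : nat -> {fset nat}) (k n : nat) : C :=
  if k isn't k'.+1 then 0 else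
  (n == 1%N)%:R - \sum_(d <- A n | (d < n)%N) mobius_rec C A k' d.

Lemma A_mobius_exists (C : pzRingType) (A : nat -> {fset nat}) :
  regular_system A -> exists mu : nat -> C, is_A_mobius A mu.
Proof.
move=> rA; exists (fun n => mobius_rec C A n n).
have recE k n : (n <= k)%N -> (0 < n)%N -> mobius_rec C A k n = mobius_rec C A n n.
  have [l] := ubnP k; elim: l k n => // l IH [|k] [|n] //= kl nk _.
  congr (_ - _); rewrite big_seq_cond [RHS]big_seq_cond.
  apply: eq_bigr => d /andP[dA dn].
  have d0 : (0 < d)%N by apply: dvdn_gt0 (rs_dvd rA _ dA).
  have dk : (d <= k)%N by exact: leq_trans dn nk.
  have nl : (n < l)%N by exact: leq_trans nk kl.
  by rewrite (IH k) // (IH n).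
move=> n n0; have [nn nC] := rs_compl rA n0.
have main : \sum_(d <- A n) mobius_rec C A d d = (n == 1%N)%:R.
  rewrite (big_fsetD1 n) //=.
  case: n n0 nn nC => // n n0 nn nC; rewrite [mobius_rec C A n.+1 n.+1]/=.
  rewrite -[RHS]addr0 -addrA; congr (_ + _); apply/eqP.
  rewrite addrC subr_eq0; apply/eqP.
  rewrite [RHS]big_mkcond [RHS](big_fsetD1 n.+1) // ltnn /= add0r.
  rewrite big_seq [RHS]big_seq; apply: eq_bigr => d.
  rewrite !inE => /andP[dn dA].
  have dv := rs_dvd rA n0 dA.
  have lt : (d < n.+1)%N by rewrite ltn_neqAle dn dvdn_leq.
  by rewrite lt recE //; apply: dvdn_gt0 dv.
split; last by rewrite /A_conv; under eq_bigr do rewrite mulr1.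
rewrite /A_conv; under eq_bigr do rewrite mul1r.
rewrite -main -(big_map (fun d => n %/ d)%N predT (fun d => mobius_rec C A d d)).
have dK d : d \in A n -> (n %/ (n %/ d))%N = d.
  move=> dA; have dv := rs_dvd rA n0 dA.
  by rewrite -{1}(divnK dv) mulKn // divn_gt0 ?(dvdn_gt0 n0) // dvdn_leq.
apply: perm_big; apply: uniq_perm.
- rewrite map_inj_in_uniq ?fset_uniq // => x y xA yA e.
  by rewrite -(dK _ xA) e dK.
- exact: fset_uniq.
- move=> d; apply/mapP/idP => [[x xA ->]|dA]; first exact: nC.
  by exists (n %/ d)%N; [exact: nC | rewrite dK].
Qed.

(* Main.v *)
Require Import Defs.
From mathcomp Require Import all_boot all_order all_algebra finmap.
From mathcomp Require Import complex.
From mathcomp Require Import reals trigo.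
From mathcomp Require Import zify ring lra.
Import Order.TTheory GRing.Theory Num.Theory.
Local Open Scope ring_scope.
Local Open Scope complex_scope.

(** Each divisor in [A n] is the product of the [p_i ^ a_i] over a subset of the
    indices, so inclusion-exclusion and geometric sums give the power sums of
    the (inverse) roots of Phi_(A,n):
    [c(j) = \prod_i (p_i ^ a_i [p_i ^ a_i | j] - 1)
          = mu n * mu ((j, n)_A) * phi_A ((j, n)_A)].
    Since Phi_(A,n) has constant term 1, it is the product of the [1 - x / alpha]
    over its roots [alpha], and Newton's identities for the elementary symmetric
    functions of the [1 / alpha] are the claimed recursion. *)

(** * Newton's identities for products of linear factors *)

(** This is the coefficient form of [X P' = - P * \sum_(j >= 1) s_j X^j] with [s_j] the [j]-th power
    sum, proved without division by induction on [s]. *)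
Lemma newton_coef_prod (F : comNzRingType) (s : seq F) (c : F) (k : nat) :
  let P := c *: \prod_(b <- s) (1 - b *: 'X) in
  P`_k *+ k = - \sum_(1 <= j < k.+1) P`_(k - j) * \sum_(b <- s) b ^+ j.
Proof.
elim: s k => [|b s IH] k /=.
  rewrite big_nil alg_polyC coefC big1 => [|j _]; last by rewrite big_nil mulr0.
  by case: k => [|k] /=; rewrite ?mulr0n ?oppr0 // mul0rn.
rewrite big_cons scalerAr; set P := (c *: _) in IH *.
have PE i : ((1 - b *: 'X) * P)`_i = P`_i - b * (if i == 0%N then 0 else P`_i.-1).
  by rewrite mulrBl mul1r coefB -[b *: _]mul_polyC -mulrA coefCM coefXM.
case: k => [|k]; first by rewrite big_geq // mulr0n oppr0.
(* The factor [1 - b X] cancels the geometric series of [b X]; the finite sum telescopes, and the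
   term [j = k.+1] has no lower coefficient to subtract. *)
have geom : \sum_(1 <= j < k.+2) ((1 - b *: 'X) * P)`_(k.+1 - j) * b ^+ j = b * P`_k.
  rewrite (eq_big_nat _ _ (F2 := fun j => P`_(k.+1 - j) * b ^+ j -
      (if j == k.+1 then 0 else P`_(k - j) * b ^+ j.+1))) => [|j jk]; last first.
    rewrite PE mulrBl; case: (eqVneq j k.+1) => [->|jne].
      by rewrite subnn eqxx mulr0 mul0r.
    have -> : (k.+1 - j == 0)%N = false by lia.
    have -> : (k.+1 - j).-1 = (k - j)%N by lia.
    by rewrite exprS; ring.
  rewrite sumrB [X in _ - X]big_nat_recr //= eqxx addr0.
  rewrite big_nat_recl // big_add1 /= subSS subn0 expr1 [b * _]mulrC -addrA.
  rewrite -[RHS]addr0; congr (_ + _); apply/eqP; rewrite subr_eq0; apply/eqP.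
  rewrite [RHS]big_add1 /=; apply: eq_big_nat => j jk; rewrite subSS ifF //; lia.
under eq_bigr => j _ do rewrite big_cons mulrDr.
rewrite big_split /= geom.
under eq_bigr => j _ do rewrite PE mulrBl.
rewrite sumrB PE /= mulrnBl IH.
(* The part shifted by [b X] is the induction hypothesis one degree lower. *)
have -> : \sum_(1 <= j < k.+2) b * (if (k.+1 - j == 0)%N then 0 else P`_(k.+1 - j).-1)
    * (\sum_(b <- s) b ^+ j) = - (b * (P`_k *+ k)).
  rewrite IH big_nat_recr //= subnn eqxx mulr0 mul0r addr0 mulrN opprK mulr_sumr.
  apply: eq_big_nat => j jk.
  have -> : (k.+1 - j == 0)%N = false by lia.
  have -> : (k.+1 - j).-1 = (k - j)%N by lia.
  by rewrite mulrA.
by rewrite mulrS -mulrnAr; ring.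
Qed.

Lemma prod_XsubC_inv (F : fieldType) (s : seq F) :
  all (fun x => x != 0) s ->
  \prod_(x <- s) ('X - x%:P) =
    (\prod_(x <- s) - x) *: \prod_(y <- [seq x^-1 | x <- s]) (1 - y *: 'X).
Proof.
elim: s => [|x s IH] /=; first by rewrite !big_nil scale1r.
case/andP=> x0 /IH; rewrite !big_cons => ->.
have -> : 'X - x%:P = - x *: (1 - x^-1 *: 'X).
  by rewrite scalerBr scalerA mulNr divff // scaleN1r alg_polyC polyCN opprK addrC.
by rewrite -scalerAl -scalerAr scalerA.
Qed.

(** * Roots of unity and their power sums *)

Lemma zetaX (R : realType) (n k : nat) :
  zeta R n ^+ k = cos (2 * pi / n%:R *+ k) +i* sin (2 * pi / n%:R *+ k).
Proof.
elim: k => [|k IH]; first by rewrite mulr0n cos0 sin0.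
rewrite exprS IH /zeta (mulrS (2 * pi / n%:R)) cosD sinD.
by apply/eqP; rewrite eq_complex /=; apply/andP; split; apply/eqP; ring.
Qed.

(** For [0 < i.+1 < n] the half angle [x] lies strictly between 0 and [pi], so [sin x > 0] and the
    real part [cos (2 x)] is not 1. *)
Lemma zeta_prim_root (R : realType) (n : nat) :
  (0 < n)%N -> n.-primitive_root (zeta R n).
Proof.
move=> n0; have nR : n%:R != 0 :> R by rewrite pnatr_eq0 -lt0n.
apply/andP; split=> //; apply/forallP => -[i /= i_n]; apply/eqP.
rewrite unity_rootE zetaX; case: (eqVneq i.+1 n) => [->|i1].
  rewrite -mulr_natr divfK // mulrC mulr_natr cos2pi.
  by rewrite sin_mulr2n sinpi mulr0 mul0rn eqxx.
apply/negbTE; rewrite eq_complex /= negb_and; apply/orP; left.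
set x := pi * i.+1%:R / n%:R : R.
have -> : 2 * pi / n%:R *+ i.+1 = x *+ 2 by rewrite /x -mulr_natr -[RHS]mulr_natr; ring.
have x0 : 0 < sin x.
  have ilt : (i.+1 < n)%N by lia.
  apply: sin_gt0_pi; rewrite divr_gt0 ?mulr_gt0 ?pi_gt0 ?ltr0n //=.
  by rewrite ltr_pdivrMr ?ltr0n // ltr_pM2l ?pi_gt0 // ltr_nat.
apply/negP => /eqP; rewrite cos_mulr2n => c1.
have := cos2Dsin2 x; have : 0 < sin x ^+ 2 by rewrite exprn_gt0.
lra.
Qed.

Lemma zeta_sqr (R : realType) (n : nat) : zeta R n.*2 ^+ 2 = zeta R n.
Proof.
rewrite zetaX /zeta; suff -> : 2 * pi / n.*2%:R *+ 2 = 2 * pi / n%:R :> R by [].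
by rewrite -muln2 natrM invfM -mulr_natr !mulrA divfK // pnatr_eq0.
Qed.

Lemma zeta_half (R : realType) (n : nat) : (0 < n)%N -> zeta R n.*2 ^+ n = -1.
Proof.
move=> n0; rewrite zetaX.
have -> : 2 * pi / n.*2%:R *+ n = pi :> R.
  rewrite -mulr_natr -muln2 natrM; field.
  by rewrite pnatr_eq0 -lt0n.
by rewrite cospi sinpi; apply/eqP; rewrite eq_complex /= oppr0 !eqxx.
Qed.

Lemma big_nat_dvdn (V : nmodType) (F : nat -> V) (d e : nat) : (0 < d)%N ->
  \sum_(1 <= m < (d * e).+1 | (d %| m)%N) F m = \sum_(1 <= l < e.+1) F (d * l)%N.
Proof.
move=> d0; elim: e => [|e IH]; first by rewrite muln0 !big_geq.
rewrite [RHS]big_nat_recr //= -IH.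
rewrite (big_cat_nat (n := (d * e).+1)) //=; last by rewrite ltnS leq_mul2l leqnSn orbT.
congr (_ + _); case: d d0 {IH} => // d _.
have dE : (d.+1 * e.+1)%N = (d.+1 * e + d).+1 by lia.
rewrite dE big_mkcond big_nat_recr ?ltnS ?leq_addr //= -dE dvdn_mulr //.
(* No multiple of [d] lies strictly between [d e] and [d (e + 1)]. *)
rewrite big_nat big1 ?add0r // => m mb.
case: ifP => // dm; move: (divnK dm) mb => <-.
rewrite mulnC !(mulnC d.+1) => /andP[]; rewrite !ltn_mul2r /= => em me.
by move: me; rewrite ltnS leqNgt em.
Qed.

(** When [z ^+ j != 1], the geometric sum times [z ^+ j - 1] is [z ^+ (j * e) - 1 = 0]. *)
Lemma sum_prim_root_pow (F : fieldType) (z : F) (e j : nat) :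
  e.-primitive_root z ->
  \sum_(1 <= l < e.+1) z ^+ (l * j) = if (e %| j)%N then e%:R else 0.
Proof.
move=> pz; under eq_bigr => l _ do rewrite mulnC exprM.
rewrite (prim_order_dvd pz).
case: eqVneq => [->|ne1].
  under eq_bigr => l _ do rewrite expr1n.
  by rewrite big_const_nat iter_addr_0 subn1.
have e0 := prim_order_gt0 pz.
rewrite big_add1 /=; under eq_bigr => l _ do rewrite exprS.
rewrite -mulr_sumr big_mkord.
apply/eqP; rewrite mulf_eq0; apply/orP; right.
have: (z ^+ j - 1) * (\sum_(i < e) (z ^+ j) ^+ i) == 0.
  by rewrite -subrX1 exprAC (prim_expr_order pz) expr1n subrr.
by rewrite mulf_eq0 subr_eq0 (negbTE ne1).
Qed.

(** * Expansion over subsets and induction on finite sets *)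

Lemma prodrD_subset (T : finType) (S : comPzRingType) (I : {set T}) (F G : T -> S) :
  \prod_(i in I) (F i + G i) =
  \sum_(J : {set T} | J \subset I) (\prod_(i in J) F i) * \prod_(i in I :\: J) G i.
Proof.
rewrite big_mkcond /=.
(* Outside [I] the summands are extended by 0 and 1, so every choice set not contained in [I]
   contributes 0. *)
rewrite (eq_bigr (fun i => (if i \in I then F i else 0) + (if i \in I then G i else 1))).
  rewrite bigA_distr [RHS]big_mkcond; apply: eq_bigr => J _.
  case: ifP => [sJI|/negbT /subsetPn[i iJ iI]]; last first.
    by rewrite (bigD1 i) //= iJ (negbTE iI) mul0r.
  rewrite (big_mkcond (mem J)) (big_mkcond (mem (I :\: J))) -big_split /=.
  apply: eq_bigr => i _; rewrite !inE; case: ifPn => iJ /=.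
    by rewrite (subsetP sJI) ?mulr1.
  by rewrite mul1r.
by move=> i _; case: ifP => _; rewrite ?add0r.
Qed.

Lemma finset_ind_setU1 (T : finType) (P : {set T} -> Prop) :
  P set0 -> (forall i (I : {set T}), i \notin I -> P I -> P (i |: I)) -> forall I, P I.
Proof.
move=> P0 PU I; have [k] := ubnP #|I|; elim: k I => // k IH I kI.
have [->//|[i iI]] := set_0Vmem I.
rewrite -(setD1K iI); apply: PU; first by rewrite !inE eqxx.
by apply: IH; move: kI; rewrite (cardsD1 i) iI.
Qed.

(** * Products of pairwise coprime A-primitive numbers *)

Section PrimitiveBlocks.
Variables (T : finType) (A : nat -> {fset nat}) (Q : T -> nat).
Hypotheses (regA : regular_system A) (Q_prim : forall i, A_primitive A (Q i)).
Hypothesis Q_coprime : forall i j, i != j -> coprime (Q i) (Q j).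

(** Indexing by subsets turns the divisors in [A (block I)] into the subsets of [I], and
    A-convolution sums into sums over subsets. *)
Definition block (I : {set T}) : nat := (\prod_(i in I) Q i)%N.

Lemma Q_gt1 i : (1 < Q i)%N. Proof. by case: (Q_prim i). Qed.

Lemma block_gt0 I : (0 < block I)%N.
Proof. by rewrite prodn_gt0 // => i; rewrite ltnW ?Q_gt1. Qed.

Lemma block0 : block set0 = 1%N. Proof. by rewrite /block big_set0. Qed.

Lemma blockU1 i (I : {set T}) : i \notin I -> block (i |: I) = (Q i * block I)%N.
Proof. exact: big_setU1. Qed.

Lemma blockD (I J : {set T}) : J \subset I -> block I = (block J * block (I :\: J))%N.
Proof. by move=> /setIidPr sJI; rewrite /block (big_setID J) sJI. Qed.

Lemma coprime_block i (I : {set T}) : i \notin I -> coprime (Q i) (block I).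
Proof.
move=> iI; apply: (big_ind (coprime (Q i))) => [||j jI]; first exact: coprimen1.
  by move=> x y cx cy; rewrite coprimeMr cx.
by apply: Q_coprime; apply: contraNneq iI => ->.
Qed.

Lemma dvd_blockP (I : {set T}) m :
  reflect (forall i, i \in I -> (Q i %| m)%N) (block I %| m)%N.
Proof.
apply: (iffP idP) => [dm i iI|].
  by apply: dvdn_trans dm; rewrite /block (big_setD1 i) //= dvdn_mulr.
elim/finset_ind_setU1: I => [_|i I iI IH dI]; first by rewrite block0 dvd1n.
rewrite blockU1 // Gauss_dvd ?coprime_block // dI ?setU11 //=.
by apply: IH => j jI; rewrite dI // setU1r.
Qed.

Lemma Q_dvd_block i (I : {set T}) : (Q i %| block I)%N = (i \in I).
Proof.
apply/idP/idP => [|iI]; last by rewrite /block (big_setD1 i) //= dvdn_mulr.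
apply: contraTT => /coprime_block/eqP cop; apply/negP => /gcdn_idPl.
by rewrite cop => Q1; have := Q_gt1 i; rewrite -Q1.
Qed.

Lemma block_inj : injective block.
Proof. by move=> I J eIJ; apply/setP=> i; rewrite -!Q_dvd_block eIJ. Qed.

Lemma block_eq1 I : (block I == 1%N) = (I == set0).
Proof. by rewrite -block0 (inj_eq block_inj). Qed.

(** Adjoining [i] multiplies the divisor set by [A (Q i)], which is 1 and [Q i]: each divisor either
    takes the new factor or not. *)
Lemma mem_A_block (I : {set T}) d :
  (d \in A (block I)) <-> exists2 J : {set T}, J \subset I & d = block J.
Proof.
elim/finset_ind_setU1: I d => [|i I iI IH] d.
  rewrite block0 (rs_1 regA) inE; split=> [/eqP ->|[J]].
    by exists set0; rewrite ?block0.
  by rewrite subset0 => /eqP -> ->; rewrite block0.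
have Qi0 : (0 < Q i)%N by rewrite ltnW ?Q_gt1.
rewrite blockU1 // (rs_coprime regA) ?block_gt0 ?coprime_block //.
have [_ AQ] := Q_prim i.
split=> [/imfset2P[d1 /= + [_ /= /IH[J sJI ->] ->]]|[J sJ ->]].
  rewrite AQ !inE => /orP[] /eqP ->; last first.
    by exists (i |: J); rewrite ?setUS // blockU1 // (contra (subsetP sJI i)).
  by exists J; rewrite ?mul1n // (subset_trans sJI) ?subsetUr.
apply/imfset2P; exists (if i \in J then Q i else 1%N) => /=.
  by rewrite AQ; case: ifP; rewrite !inE eqxx ?orbT.
exists (block (J :\ i)).
  by apply/IH; exists (J :\ i) => //; rewrite subDset.
case: ifP => iJ; first by rewrite -blockU1 ?setD1K // !inE eqxx.
by rewrite mul1n (setDidPl _) // disjoint_sym disjoints1 iJ.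
Qed.

Lemma big_A_block (R : Type) (idx : R) (op : Monoid.com_law idx) (F : nat -> R) I :
  \big[op/idx]_(d <- A (block I)) F d =
  \big[op/idx]_(J : {set T} | J \subset I) F (block J).
Proof.
rewrite -[RHS]big_filter -(big_map block predT F) /=; apply: perm_big; apply: uniq_perm.
- exact: fset_uniq.
- by rewrite (map_inj_uniq block_inj) filter_uniq ?index_enum_uniq.
move=> d; apply/idP/mapP => [/mem_A_block[J sJI ->]|[J]].
  by exists J => //; rewrite mem_filter sJI mem_index_enum.
by rewrite mem_filter => /andP[sJI _] ->; apply/mem_A_block; exists J.
Qed.

(** A block divides [j] exactly when all its factors do, so the candidates are the blocks of subsets
    of [K], and [block K] is the largest. *)
Lemma A_gcd_block (j : nat) I :
  A_gcd A j%:Z (block I) = block [set i in I | (Q i %| j)%N].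
Proof.
set K := [set _ in _ | _].
have sKI : K \subset I by apply/subsetP => i; rewrite inE => /andP[].
rewrite /A_gcd; apply/eqP; rewrite eqn_leq; apply/andP; split.
  rewrite big_seq_cond; apply/bigmax_leqP_seq => d _ /andP[/mem_A_block[J sJI ->] dJ].
  apply: dvdn_leq; first exact: block_gt0.
  apply/dvd_blockP => i iJ; rewrite Q_dvd_block inE (subsetP sJI) //=.
  by apply: dvd_blockP iJ.
apply: (@leq_bigmax_seq _ _ _ (fun d => d) (block K)).
  by apply/mem_A_block; exists K.
by apply/dvd_blockP => i; rewrite inE => /andP[].
Qed.

Lemma A_gcd_block_eq1 (j : nat) I :
  (A_gcd A j%:Z (block I) == 1%N) = [forall i in I, ~~ (Q i %| j)%N].
Proof.
rewrite A_gcd_block block_eq1; apply/eqP/forall_inP => [K0 i iI|K0].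
  by apply/negP => Qj; have := in_set0 i; rewrite -K0 inE iI Qj.
by apply/setP => i; rewrite !inE; apply/negP => /andP[/K0/negP].
Qed.

(** * Möbius values, power sums and totients of blocks *)

(** The inverse relation and the expansion of [\prod_(i in I) (-1 + 1)] are sums over subsets with
    the same value; by induction they agree on proper subsets, hence at [I]. *)
Lemma mobius_block (C : comPzRingType) (mu : nat -> C) I :
  is_A_mobius A mu -> mu (block I) = (-1) ^+ #|I|.
Proof.
move=> muP; have [k] := ubnP #|I|; elim: k I => // k IH I kI.
have [_ +] := muP _ (block_gt0 I).
rewrite /A_conv; under eq_bigr do rewrite mulr1.
rewrite big_A_block block_eq1 (bigD1 I) //=.
rewrite (eq_bigr (fun J : {set T} => (-1) ^+ #|J|)) => [|J sJ]; last first.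
  apply: IH; rewrite -ltnS; apply: leq_trans kI.
  by rewrite ltnS proper_card // properEneq andbC.
have : \prod_(i in I) (-1 + 1) = (I == set0)%:R :> C.
  have [->|[i iI]] := set_0Vmem I; first by rewrite big_set0 eqxx.
  rewrite (bigD1 i) //= addNr mul0r; case: eqP => // I0.
  by rewrite I0 inE in iI.
rewrite prodrD_subset (bigD1 I) //= => <-.
rewrite prodr_const setDv big_set0 mulr1 => /eqP; set S := (X in _ + X == _).
set S' := (X in _ == _ + X); suff -> : S' = S by move/eqP/addIr.
by apply: eq_bigr => J _; rewrite prodr_const big1 ?mulr1.
Qed.

(** Inclusion-exclusion: the condition on [m] is the product of [1 - [Q i divides m]]. Expanding
    both sides over [J], the terms are matched one by one. *)
Lemma sum_A_coprime_root_pow (F : fieldType) (z : F) I j :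
  (block I).-primitive_root z ->
  \sum_(1 <= m < (block I).+1 | A_gcd A m%:Z (block I) == 1%N) z ^+ (m * j) =
  \prod_(i in I) (-1 + if (Q i %| j)%N then (Q i)%:R else 0).
Proof.
move=> pz; rewrite prodrD_subset big_mkcond /=.
transitivity (\sum_(1 <= m < (block I).+1) \sum_(J : {set T} | J \subset I)
    (-1) ^+ #|J| * (if (block J %| m)%N then z ^+ (m * j) else 0)).
  apply: eq_bigr => m _.
  have -> : (if A_gcd A m%:Z (block I) == 1%N then z ^+ (m * j) else 0) =
      \prod_(i in I) (- (Q i %| m)%N%:R + 1) * z ^+ (m * j).
    rewrite A_gcd_block_eq1; case: (boolP [forall i in I, _]) => [/forall_inP K0|].
      by rewrite big1 ?mul1r // => i /K0/negbTE ->; rewrite oppr0 add0r.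
    rewrite negb_forall_in => /exists_inP[i iI]; rewrite negbK => Qm.
    by rewrite (bigD1 i) //= Qm addNr !mul0r.
  rewrite prodrD_subset mulr_suml; apply: eq_bigr => J _.
  rewrite [X in _ * X * _]big1 // mulr1.
  under eq_bigr do rewrite -mulN1r.
  rewrite big_split /= prodr_const -mulrA; congr (_ * _).
  case: dvd_blockP => [dm|dm].
    by rewrite big1 ?mul1r // => i /dm ->.
  have [i iJ /negbTE Qm] : exists2 i, i \in J & ~~ (Q i %| m)%N.
    apply/exists_inP; rewrite -negb_forall_in; apply/negP => /forall_inP; exact: dm.
  by rewrite (bigD1 i) //= Qm !mul0r.
rewrite exchange_big /=; apply: eq_bigr => J sJI.
rewrite prodr_const -mulr_sumr; congr (_ * _).
have bE := blockD _ _ sJI; rewrite -big_mkcond bE big_nat_dvdn ?block_gt0 //.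
under [LHS]eq_bigr do rewrite -mulnA exprM.
(* Raising [z] to the power [block J] leaves a primitive root of order [block (I :\: J)]. *)
rewrite sum_prim_root_pow; last first.
  have := dvdn_prim_root pz; rewrite bE => /(_ (block (I :\: J))) /=.
  by rewrite mulnK ?block_gt0 // => -> //; rewrite dvdn_mull.
case: dvd_blockP => [dj|dj].
  by rewrite /block natr_prod; apply: eq_bigr => i /dj ->.
have [i iJ /negbTE Qj] : exists2 i, i \in I :\: J & ~~ (Q i %| j)%N.
  apply/exists_inP; rewrite -negb_forall_in; apply/negP => /forall_inP; exact: dj.
by rewrite (bigD1 i) //= Qj mul0r.
Qed.

(** The totient is the power sum with exponent 0, all of whose terms are 1. *)
Lemma A_totient_block (F : fieldType) (z : F) I :
  (block I).-primitive_root z ->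
  (A_totient A (block I))%:R = \prod_(i in I) ((Q i)%:R - 1) :> F.
Proof.
move=> pz; rewrite /A_totient size_filter -sum1_count natr_sum.
rewrite (eq_bigr (fun m => z ^+ (m * 0))) => [|m _]; last by rewrite muln0.
rewrite sum_A_coprime_root_pow //.
by apply: eq_bigr => i _; rewrite dvdn0 addrC.
Qed.

(** The product formula splits at the [Q i] dividing [j]: these give the totient of the gcd, the
    others give signs. The root [z] is arbitrary so that the inverse of [zeta R n] can be used. *)
Lemma sum_A_coprime_root_pow_mobius (R : realType) (mu : nat -> R[i]) (z : R[i]) I j :
  is_A_mobius A mu -> (block I).-primitive_root z ->
  \sum_(1 <= m < (block I).+1 | A_gcd A m%:Z (block I) == 1%N) z ^+ (m * j) =
  mu (block I) * (mu (A_gcd A j%:Z (block I)) *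
    (A_totient A (A_gcd A j%:Z (block I)))%:R).
Proof.
move=> muP pz; rewrite sum_A_coprime_root_pow // A_gcd_block !mobius_block //.
set K := [set _ in _ | _].
rewrite (A_totient_block _ _ _ (zeta_prim_root R _ (block_gt0 K))) -!prodr_const.
have sKI : K \subset I by apply/subsetP => i; rewrite inE => /andP[].
have splitK (G : T -> R[i]) :
    \prod_(i in I) G i = \prod_(i in K) G i * \prod_(i in I :\: K) G i.
  by rewrite (big_setID K) /= (setIidPr sKI).
rewrite !splitK mulrAC -!big_split /=.
congr (_ * _).
  apply: eq_bigr => i; rewrite inE => /andP[_ ->].
  by rewrite addrC mulrA mulrNN !mul1r.
apply: eq_bigr => i; rewrite !inE => /andP[+ iI]; rewrite iI /= => /negbTE ->.
by rewrite addr0.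
Qed.

(* With [w] a primitive root of order [2 n], [- zeta_n ^+ m = w ^+ (n + 2 m)],
   and the involution [m |-> n - m] shows that these exponents add up to a
   multiple of [2 n]. *)
Lemma prod_A_coprime_zeta (R : realType) I : I != set0 ->
  \prod_(1 <= m < (block I).+1 | A_gcd A m%:Z (block I) == 1%N)
     - zeta R (block I) ^+ m = 1.
Proof.
move=> I0; set n := block I; have n0 : (0 < n)%N := block_gt0 I.
set w := zeta R n.*2.
have -> : forall P : pred nat, \prod_(1 <= m < n.+1 | P m) - zeta R n ^+ m =
    w ^+ \sum_(1 <= m < n.+1 | P m) (n + m.*2)%N.
  move=> P; rewrite expr_sum; apply: eq_bigr => m _.
  by rewrite exprD zeta_half // mulN1r -mul2n exprM zeta_sqr.
(* The term [m = n] drops out, its gcd being [n], which is not 1 as [I] is nonempty; the remaining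
   range is stable under the involution. *)
rewrite big_mkcond big_nat_recr //= [A_gcd _ _ _]A_gcd_block.
have -> : [set i in I | (Q i %| n)%N] = I.
  by apply/setP => i; rewrite inE Q_dvd_block andbb.
rewrite block_eq1 (negbTE I0) addn0 -big_mkcond /= .
set S := (\sum_(_ <= m < _ | _) _)%N.
have S_rev : S = (\sum_(1 <= m < n | A_gcd A m%:Z n == 1) (n + (n - m).*2))%N.
  rewrite /S big_nat_rev big_nat_cond [RHS]big_nat_cond; apply: eq_big => m.
    rewrite add1n subSS; case: (boolP (1 <= m < n)%N) => //= /andP[_ m_lt].
    rewrite !A_gcd_block_eq1; apply: eq_forallb_in => i iI; congr (~~ _).
    by rewrite dvdn_subr ?Q_dvd_block // ltnW.
  by rewrite add1n subSS.
(* Paired exponents satisfy [(n + 2 m) + (n + 2 (n - m)) = 4 n]. *)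
have S2 : (S + S = 2 * \sum_(1 <= m < n | A_gcd A m%:Z n == 1) n.*2)%N.
  rewrite {1}S_rev /S -big_split big_distrr big_nat_cond [RHS]big_nat_cond /=.
  by apply: eq_bigr => m /andP[mn _]; lia.
have : (n.*2 %| S)%N.
  move: S2; rewrite addnn -mul2n => /eqP; rewrite eqn_pmul2l // => /eqP ->.
  by apply: dvdn_sum => m _.
by rewrite (prim_order_dvd (zeta_prim_root R n.*2 _)) ?double_gt0 // => /eqP.
Qed.

End PrimitiveBlocks.

Theorem theorem12 (R : realType) (A : nat -> {fset nat}) (mu : nat -> R[i])
    (r : nat) (p a : 'I_r -> nat) (n : nat)
    (regA : regular_system A) (muP : is_A_mobius A mu)
    (r_ge1 : (1 <= r)%N)
    (p_prime : forall i, prime (p i)) (p_inj : injective p)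
    (pa_prim : forall i, A_primitive A (p i ^ a i)%N)
    (nE : n = (\prod_(i < r) p i ^ a i)%N) :
  (A_cyclotomic R A n)`_0 = 1 /\
  forall k : nat, (1 <= k <= A_totient A n)%N ->
    (A_cyclotomic R A n)`_k =
      - (mu n / k%:R) *
        \sum_(1 <= j < k.+1)
          (A_cyclotomic R A n)`_(k - j) * mu (A_gcd A j%:Z n)
            * (A_totient A (A_gcd A j%:Z n))%:R.
Proof.
pose Q i := (p i ^ a i)%N.
have Q_coprime i j : i != j -> coprime (Q i) (Q j).
  move=> ij; rewrite coprimeXl // coprimeXr // prime_coprime // dvdn_prime2 //.
  by rewrite (inj_eq p_inj).
(* Nonemptiness excludes [n = 1], where the polynomial is [X - 1], with constant term [-1]. *)
have I0 : [set: 'I_r] != set0 by apply/set0Pn; exists (Ordinal r_ge1).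
have {nE} nE : n = block _ Q setT.
  by rewrite nE /block; apply: eq_bigl => i; rewrite inE.
have n0 : (0 < n)%N by rewrite nE (block_gt0 _ _ _ pa_prim).
have pz := zeta_prim_root R _ n0.
set z := zeta R n in pz; have z0 : z != 0.
  by rewrite (prim_root_eq0 pz) -lt0n.
pose s := [seq z ^+ m | m <- index_iota 1 n.+1 & A_gcd A m%:Z n == 1%N].
have PhiE : A_cyclotomic R A n = \prod_(y <- [seq x^-1 | x <- s]) (1 - y *: 'X).
  rewrite /A_cyclotomic -big_filter.
  rewrite -(big_map (fun m => z ^+ m) predT (fun x => 'X - x%:P)).
  rewrite prod_XsubC_inv -/s; last by apply/allP => _ /mapP[m _ ->]; rewrite expf_neq0.
  suff -> : \prod_(x <- s) - x = 1 by rewrite scale1r.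
  rewrite big_map big_filter /z nE; exact: prod_A_coprime_zeta.
split.
  by rewrite PhiE coef0_prod big1 // => y _; rewrite coefB coefZ coefX mulr0 subr0 coef1.
move=> k /andP[k0 _].
have kR : k%:R != 0 :> R[i] by rewrite pnatr_eq0 -lt0n.
have := newton_coef_prod _ [seq x^-1 | x <- s] 1 k.
rewrite /= scale1r -PhiE -[_ *+ k]mulr_natr => newton.
rewrite -[LHS](mulfK kR) newton.
rewrite !mulNr [X in _ = - X]mulrAC mulr_sumr.
congr (- (_ / _)); apply: eq_bigr => j _.
rewrite mulrCA -mulrA; congr (_ * _).
rewrite !big_map big_filter.
(* The power sums run over inverse roots, that is, over powers of [z^-1 = z ^+ n.-1], again
   primitive since [n.-1] is coprime to [n]. *)
have pz' : n.-primitive_root z^-1.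
  have -> : z^-1 = z ^+ n.-1.
    by apply: (mulfI z0); rewrite divff // -exprS prednK // prim_expr_order.
  by rewrite (prim_root_exp_coprime _ pz) coprimePn.
under eq_bigr do rewrite -exprVn -exprM.
rewrite mulrCA; move: pz'; rewrite nE.
exact: (sum_A_coprime_root_pow_mobius _ _ Q regA pa_prim Q_coprime).
Qed.
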